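(* A poset $P$ on $\{1,2,\dots,n\}$ is sleek if and only if there do not exist integers $a<b<c<d$ in $\{1,\dots,n\}$ such that the induced subposet of $P$ on $\{a,b,c,d\}$ has exactly one of the following sets of strict order relations: (i) $a<_P c$ and $b<_P d$ (and no others); (ii) $a<_P d$ and $b<_P c$ (and no others); (iii) $a<_P b<_P d$ (so also $a<_P d$), with $c$ incomparable to $a,b,d$; (iv) $a<_P c<_P d$ (so also $a<_P d$), with $b$ incomparable to $a,c,d$.
   Context: A semiorder on $\{1,\dots,n\}$ is a poset $Q$ for which there exist real numbers $y_1,\dots,y_n$ such that $i<_Q j$ if and only if $y_j-y_i>1$. A poset $P$ on $\{1,\dots,n\}$ is sleek if there is a semiorder $Q$ on $\{1,\dots,n\}$ such that $i<_P j$ if and only if $i<_Q j$ and $i<j$ (i.e. $P$ is the intersection of a semiorder with the chain $1<2<\cdots<n$).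
   Formalization: The formal theorem assumes that i <_P j implies i < j; without this the claim fails (n = 2 with the single relation 2 <_P 1 has no obstruction but is not sleek), and every sleek poset satisfies it. *)

(* Defs.v *)
From mathcomp Require Import all_boot all_order all_algebra.
From mathcomp Require Import reals.
Set Implicit Arguments. Unset Strict Implicit. Unset Printing Implicit Defensive.
Import Order.TTheory GRing.Theory Num.Theory.
Local Open Scope ring_scope.

(* The ground set {1, ..., n} is 'I_n = {0, ..., n-1}, ordered by the values
   of its elements.  A poset on it is given by its strict order relation. *)
Definition strict_poset n (P : rel 'I_n) : Prop :=
  irreflexive P /\ transitive P.

(* P is contained in the chain 1 < 2 < ... < n. *)
Definition natural n (P : rel 'I_n) : Prop :=
  forall i j : 'I_n, P i j -> (i < j)%N.

Definition semiorder (R : realType) n (Q : rel 'I_n) : Prop :=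
  strict_poset Q /\
  exists y : 'I_n -> R, forall i j : 'I_n, Q i j <-> y j - y i > 1.

Definition sleek (R : realType) n (P : rel 'I_n) : Prop :=
  exists Q : rel 'I_n, semiorder R Q /\
    forall i j : 'I_n, P i j <-> Q i j /\ (i < j)%N.

(* The subposet induced by P on the elements of s has exactly the strict
   relations listed in r, each pair (x, y) of r standing for x <_P y. *)
Definition induced_relations n (P : rel 'I_n) (s : seq 'I_n)
    (r : seq ('I_n * 'I_n)) : Prop :=
  {in s &, forall x y, P x y = ((x, y) \in r)}.

(* The four sets are distinct when a < b < c < d, so at most one
   of the disjuncts can hold. *)
Definition obstruction n (P : rel 'I_n) (a b c d : 'I_n) : Prop :=
  let rels r := induced_relations P [:: a; b; c; d] r in
  [\/ rels [:: (a, c); (b, d)],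
      rels [:: (a, d); (b, c)],
      rels [:: (a, b); (b, d); (a, d)]
    | rels [:: (a, c); (c, d); (a, d)] ].

(* A poset that is not natural is never sleek, although it may have no
   obstruction: for n = 2, take the single relation 2 <_P 1.  The
   characterization of sleekness is thus about natural posets only. *)
Lemma sleek_natural (R : realType) n (P : rel 'I_n) : sleek R P -> natural P.
Proof. by case=> Q [_ PQ] i j /PQ[]. Qed.

(* Main.v *)
(* A real representation y of P (y j - y i > 1 iff i <_P j, for i < j) forces
   y a < y d whenever, for some b, either a <_P b, d <= b, not d <_P b, or
   b <_P d, b <= a, not b <_P a.  The four obstructions are exactly the ways in
   which this relation T can contain a 2-cycle.  An edge a -> d of T never lets
   a point x sit between a and d unless T a x or T x d, which allows any longer
   cycle to be shortened at its least point; so without obstructions T is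
   acyclic.  Rank the points compatibly with T and close P upwards: let a <_Q d
   if a' <_P d' for some a' of rank at least that of a and some d' of rank at
   most that of d.  This Q meets the chain 1 < ... < n in P only, because any
   additional relation would contradict the ranking, and it is a semiorder: a <_Q d
   says that the rank of a is below a nondecreasing threshold of the rank of d,
   so that y can be chosen greedily, rank by rank. *)

Require Import Defs.
From mathcomp Require Import all_boot all_order all_algebra.
From mathcomp Require Import reals.
From mathcomp Require Import zify lra.

Set Implicit Arguments. Unset Strict Implicit. Unset Printing Implicit Defensive.
Import Order.TTheory GRing.Theory Num.Theory.

(** * Real representation of a threshold relation *)

Section ThresholdRepresentation.
Variables (R : realFieldType) (q : nat -> nat).
Hypothesis q_homo : {homo q : m k / m <= k}.
Hypothesis q_le : forall k, q k <= k.
Local Open Scope ring_scope.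

(** Values are chosen one point at a time; the strict bound [g k < g m + 1] leaves an open interval
    for the next one. *)
Lemma threshold_prefix N : exists g : nat -> R, forall m k, (m < k < N)%N ->
  g m < g k /\ (if (m < q k)%N then g m + 1 < g k else g k < g m + 1).
Proof.
elim: N => [|N [g gP]]; first by exists (fun=> 0) => m k; rewrite ltn0 andbF.
have g_le m k : (m <= k < N)%N -> g m <= g k.
  rewrite leq_eqVlt => /andP[/orP[/eqP->//|mk] kN].
  by have [|/ltW] := gP m k; rewrite ?mk.
suff [v vP] : exists v, forall m, (m < N)%N ->
    g m < v /\ (if (m < q N)%N then g m + 1 < v else v < g m + 1).
  exists (fun k => if k == N then v else g k) => m k /andP[mk].
  rewrite ltnS leq_eqVlt => /orP[/eqP kN|kN].
    by subst k; rewrite eqxx (ltn_eqF mk); apply: vP.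
  by rewrite (ltn_eqF kN) (ltn_eqF (ltn_trans mk kN)); apply: (gP m k); rewrite mk.
have := q_le N; rewrite leq_eqVlt => /orP[/eqP qN|qN].
  exists (g N.-1 + 2) => m mN; rewrite qN mN.
  have : g m <= g N.-1 by apply: g_le; lia.
  by move=> ?; split; lra.
(* The best lower bound for the new value. If [q N = 0], no gap of 1 is required, but [(q N).-1]
   would impose one after point 0. *)
pose L := if (0 < q N)%N then Num.max (g N.-1) (g (q N).-1 + 1) else g N.-1.
have LU : L < g (q N) + 1.
  have gN : g N.-1 < g (q N) + 1.
    have : (q N <= N.-1)%N by lia.
    rewrite leq_eqVlt => /orP[/eqP<-|qN1]; first lra.
    have [|_] := gP (q N) N.-1; first by rewrite qN1; lia.
    by have := q_homo (leq_pred N); case: ltnP => // ? ?; lia.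
  rewrite /L; case: ifP => // q0; rewrite gt_max gN /=.
  by have [|] := gP (q N).-1 (q N); [lia|lra].
exists ((L + (g (q N) + 1)) / 2) => m mN.
have gm : g m <= g N.-1 by apply: g_le; lia.
have gL : g N.-1 <= L by rewrite /L; case: ifP => // _; rewrite le_max lexx.
split; first lra.
case: ltnP => mq.
  have : g m <= g (q N).-1 by apply: g_le; lia.
  have : g (q N).-1 + 1 <= L by rewrite /L (leq_trans _ mq) // le_max lexx orbT.
  lra.
have : g (q N) <= g m by apply: g_le; lia.
lra.
Qed.

Lemma threshold_representation N : exists g : nat -> R,
  forall m k, (m < N)%N -> (k < N)%N -> (1 < g k - g m) = (m < q k)%N.
Proof.
have [g gP] := threshold_prefix N; exists g => m k mN kN.
case: (ltngtP m k) => [mk|km|->].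
- have [|_] := gP m k; first by rewrite mk.
  by case: ifP => _ ?; apply/idP/idP => //; lra.
- have [|? _] := gP k m; first by rewrite km.
  by have := q_le k; case: (ltnP m) => ? ?; [lia|apply/negbTE; rewrite -leNgt; lra].
- by have := q_le k; rewrite subrr ltr10 ltnNge => ->.
Qed.

End ThresholdRepresentation.

(* [i <_P j] reads [y i + 1 < y j], and [i < j] without [i <_P j] reads
   [y j - 1 <= y i]; [forced_lt] collects the inequalities [y a < y d] obtained
   by adding one inequality of each kind.  Taking [b = d] in the first disjunct
   shows that it contains P. *)
Definition forced_lt n (P : rel 'I_n) : rel 'I_n := fun a d =>
  [exists b, [&& P a b, d <= b & ~~ P d b]]
  || [exists b, [&& P b d, b <= a & ~~ P b a]].

Lemma ord_ltn_eqF n (i j : 'I_n) : i < j -> (i == j = false) * (j == i = false).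
Proof. by move=> ij; split; apply/eqP => /(congr1 val) /=; lia. Qed.

(** * Forced inequalities and their ranking *)

Section ForcedOrder.
Variables (n : nat) (P : rel 'I_n).
Hypotheses (P_irr : irreflexive P) (P_trans : transitive P) (P_nat : natural P).
Local Notation T := (forced_lt P).

Lemma forced_ltP (a d : 'I_n) :
  reflect ((exists b, [/\ P a b, d <= b & ~~ P d b]) \/
           (exists b, [/\ P b d, b <= a & ~~ P b a])) (T a d).
Proof.
by apply: (iffP orP) => -[] h; [left|right|left|right];
  [have /existsP[b /and3P[]] := h|have /existsP[b /and3P[]] := h
  |apply/existsP; case: h => b []|apply/existsP; case: h => b []] => *;
  exists b => //; apply/and3P.
Qed.

Lemma forced_lt_sub a d : P a d -> T a d.
Proof. by move=> Pad; apply/forced_ltP; left; exists d; rewrite P_irr. Qed.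

Lemma forced_lt_irr a : ~~ T a a.
Proof. by apply/forced_ltP => -[] [b [-> ]]. Qed.

(* If [b] witnesses [T a d] in the first way and [x <= b], then [x <_P b] gives
   [T x d] and otherwise [T a x]; if [b < x], then [x] lies above [a] and [d]. *)
Lemma forced_lt_between (a d x : 'I_n) : T a d ->
  [\/ T a x, T x d, (a < x) && (d < x) | (x < a) && (x < d)].
Proof.
move/forced_ltP => [] [b [Pb le_b NPb]]; have lt_b := P_nat Pb.
- have [xb|bx] := leqP x b; last by constructor 3; lia.
  have [Px|NPx] := boolP (P x b).
    by constructor 2; apply/forced_ltP; left; exists b.
  by constructor 1; apply/forced_ltP; left; exists b.
- have [bx|xb] := leqP b x; last by constructor 4; lia.
  have [Px|NPx] := boolP (P b x).
    by constructor 1; apply/forced_ltP; right; exists b.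
  by constructor 2; apply/forced_ltP; right; exists b.
Qed.

(* The least point [a] of a cycle can be cut out of it: for its neighbours
   [z -> a -> b], [forced_lt_between] applied to [a -> b] and to [z -> a] gives
   [T z b], as otherwise both [b < z] and [z < b]. *)
Lemma forced_lt_acyclic : (forall a d, T a d -> ~~ T d a) ->
  forall c, c != [::] -> ~~ cycle T c.
Proof.
move=> T_asym c; have [m] := ubnP (size c); elim: m c => // m IHm c.
case: c => // a0 c0; set c := a0 :: c0 => size_c _; apply/negP => cyc_c.
have a0c : a0 \in c by rewrite mem_head.
case: (arg_minnP val a0c) => a ac min_a.
have [i w def_w] := rot_to ac.
have {min_a} min_w x : x \in w -> a <= x.
  move=> xw; have : x \in rot i c by rewrite def_w inE xw orbT.
    by rewrite mem_rot; apply: min_a.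
have {}size_c : size w < m by rewrite -ltnS -[(size w).+1]/(size (a :: w)) -def_w size_rot.
move: cyc_c; rewrite -(rot_cycle i) def_w {i def_w ac c a0c}.
case: w => [|b w] in min_w size_c *; first by rewrite /= andbT (negPf (forced_lt_irr a)).
rewrite /= rcons_path => /and3P[Tab path_w]; set z := last b w => Tza.
have zw : z \in b :: w by rewrite mem_last.
have NTzb : ~~ T z b.
  by have := IHm (b :: w) size_c isT; rewrite /= rcons_path path_w.
have := forced_lt_between z Tab; have := forced_lt_between b Tza.
rewrite (negPf NTzb) (negPf (T_asym _ _ Tab)) (negPf (T_asym _ _ Tza)).
have := min_w _ zw; have := min_w b (mem_head _ _).
by move=> ? ? [] // ? [] // ?; lia.
Qed.

Definition forced_rank (d : 'I_n) : nat := #|[pred x | connect T x d]|.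

(** Whatever reaches [a] reaches [d], and [d] cannot reach [a] without closing a cycle. *)
Lemma forced_rank_lt : (forall a d, T a d -> ~~ T d a) ->
  forall a d, T a d -> forced_rank a < forced_rank d.
Proof.
move=> T_asym a d Tad; apply/proper_card/properP; split.
  apply/subsetP => x; rewrite !inE => /connect_trans; apply.
  exact: connect1.
exists d; rewrite !inE ?connect0 //; apply/negP => /connectP[p path_p def_a].
have /negP[] := forced_lt_acyclic T_asym (c := d :: p) isT.
by rewrite /= rcons_path path_p -def_a.
Qed.

Lemma sleek_of_forced_lt (R : realType) :
  (forall a d, T a d -> ~~ T d a) -> sleek R P.
Proof.
move=> T_asym; pose s := forced_rank.
have s_lt a d : T a d -> s a < s d by apply: forced_rank_lt.
have sN a d : s a <= s d -> ~~ T d a.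
  by rewrite leqNgt; apply: contra; apply: s_lt.
(* [s a < q (s d)] holds iff some [a' <_P d'] has [s a <= s a'], [s d' <= s d]. *)
pose q k := \max_(p : 'I_n * 'I_n | P p.1 p.2 && (s p.2 <= k)) (s p.1).+1.
have q_homo : {homo q : m k / m <= k}.
  move=> m k mk; apply/bigmax_leqP => p /andP[Pp pm].
  by apply: (bigop.bigmax_sup p) => //; rewrite Pp (leq_trans pm).
have q_le k : q k <= k.
  by apply/bigmax_leqP => p /andP[/forced_lt_sub/s_lt Pp]; apply: leq_trans.
have [g gP] := threshold_representation R q_homo q_le n.+1.
have s_n a : s a < n.+1 by rewrite ltnS -[leqRHS]card_ord max_card.
exists (fun i j => 1 < g (s j) - g (s i))%R; split; first split.
- by split=> [i|j i k] /=; [rewrite subrr ltr10|move=> ? ?; lra].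
- by exists (g \o s).
move=> a d; rewrite gP //; split=> [Pad|[sq ad]].
  by split; [apply: (bigop.bigmax_sup (a, d)); rewrite /= ?Pad ?leqnn|exact: P_nat].
have [[a' d'] /andP[/= Pad' dd'] aa'] :
    exists2 p : 'I_n * 'I_n, P p.1 p.2 && (s p.2 <= s d) & s a <= s p.1.
  apply/exists_inP; apply: contraTT sq => /exists_inPn h.
  by rewrite -leqNgt; apply/bigmax_leqP => p /h; rewrite -ltnNge.
apply: contraT => NPad; have ad' := P_nat Pad'.
have NTd := sN _ _ dd'; have NTa := sN _ _ aa'.
(* Every case ends in [T a' a] or [T d d'], against the ranks. *)
have [a'd|da'] := ltnP a' d.
  have [Pa'd|NPa'd] := boolP (P a' d).
    by case/negP: NTa; apply/forced_ltP; left; exists d; split=> //; lia.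
  by case/negP: NTd; apply/forced_ltP; right; exists a'; split=> //; lia.
have [Pad2|NPad2] := boolP (P a d').
  by case/negP: NTd; apply/forced_ltP; right; exists a; split=> //; lia.
by case/negP: NTa; apply/forced_ltP; left; exists d'; split=> //; lia.
Qed.

(** The six increasing pairs suffice, since [P] and [r] relate no others. *)
Lemma induced_relationsP (a b c d : 'I_n) r :
  all (fun p : 'I_n * 'I_n => p.1 < p.2) r ->
  a < b -> b < c -> c < d ->
  [/\ P a b = ((a, b) \in r), P a c = ((a, c) \in r) & P a d = ((a, d) \in r)] ->
  [/\ P b c = ((b, c) \in r), P b d = ((b, d) \in r) & P c d = ((c, d) \in r)] ->
  induced_relations P [:: a; b; c; d] r.
Proof.
move=> /allP r_lt ab bc cd [Pab Pac Pad] [Pbc Pbd Pcd].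
have down (x y : 'I_n) : y <= x -> P x y = ((x, y) \in r).
  rewrite leqNgt => yx; apply/idP/idP => [/P_nat|/r_lt /=] xy;
  by rewrite xy in yx.
move=> x y; rewrite !inE => xs ys.
have [/down//|] := leqP y x.
have ac := ltn_trans ab bc; have bd := ltn_trans bc cd; have ad := ltn_trans ab bd.
by case/or4P: xs => /eqP->; case/or4P: ys => /eqP-> //; rewrite ?ltnn // => /ltnW;
  rewrite leqNgt ?ab ?ac ?ad ?bc ?bd ?cd.
Qed.

(** In a 2-cycle, witnesses [b], [c] of the same kind yield (i) or (ii), depending on their order;
    witnesses of different kinds yield (iii) or (iv). *)
Lemma forced_lt_asym :
  ~ (exists a b c d : 'I_n,
       [/\ a < b, b < c, c < d & obstruction P a b c d]) ->
  forall a d, T a d -> ~~ T d a.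
Proof.
move=> Nobs a d Tad; apply/negP => Tda.
wlog ltda : a d Tad Tda / d < a.
  move=> W; case: (ltngtP d a) => [|/W|/val_inj da]; [exact: W|exact|].
  by move: Tad; rewrite da (negPf (forced_lt_irr a)).
(* Transitivity supplies the non-relations that the witnesses do not state. *)
have NP x y z : P x y -> ~~ P x z -> ~~ P y z.
  by move=> Pxy; apply: contra => /(P_trans Pxy).
have NP' x y z : P y z -> ~~ P x z -> ~~ P x y.
  by move=> Pyz; apply: contra => /P_trans; apply.
apply: Nobs.
have ne_le (x y : 'I_n) : x <= y -> x != y -> x < y.
  by move=> xy /eqP nxy; rewrite ltn_neqAle xy andbT; apply/eqP => /val_inj.
have obs (w x y z : 'I_n) (wx : w < x) (xy : x < y) (yz : y < z) :
    obstruction P w x y z ->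
    exists a b c d : 'I_n,
       [/\ a < b, b < c, c < d & obstruction P a b c d].
  by exists w, x, y, z.
have ne := @ord_ltn_eqF n.
have E (w x y z : 'I_n) (wx : w < x) (xy : x < y) (yz : y < z) :=
  (ne _ _ wx, ne _ _ xy, ne _ _ yz, ne _ _ (ltn_trans wx xy),
   ne _ _ (ltn_trans xy yz), ne _ _ (ltn_trans (ltn_trans wx xy) yz)).
case/forced_ltP: Tad => [] [b [Pb le_b NPb]]; have lt_b := P_nat Pb;
case/forced_ltP: Tda => [] [c [Pc le_c NPc]]; have lt_c := P_nat Pc.
- have NPda := NP' _ _ _ Pb NPb.
  have NPbc := NP _ _ _ Pb NPc; have NPcb := NP _ _ _ Pc NPb.
  have {le_c}ac : a < c by apply: ne_le => //; apply: contraNneq NPda => ->.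
  case: (ltngtP b c) => [bc|cb|/val_inj bc]; last by rewrite bc Pc in NPb.
  + apply: (obs d a b c) => //; apply: Or42; apply: induced_relationsP => //=; rewrite ?lt_c ?lt_b //;
    by rewrite !inE !xpair_eqE !eqxx !(E _ _ _ _ ltda lt_b bc) /= ?Pb ?Pc; split=> //; apply/negbTE.
  + apply: (obs d a c b) => //; apply: Or41; apply: induced_relationsP => //=; rewrite ?lt_c ?lt_b //;
    by rewrite !inE !xpair_eqE !eqxx !(E _ _ _ _ ltda ac cb) /= ?Pb ?Pc; split=> //; apply/negbTE.
- have NPda := NP' _ _ _ Pb NPb.
  have {le_c}cd : c < d by apply: ne_le => //; apply: contraNneq NPda => <-.
  have Pcb := P_trans Pc Pb; have cb := P_nat Pcb.
  apply: (obs c d a b) => //; apply: Or44; apply: induced_relationsP => //=; rewrite ?lt_c ?lt_b ?cb //;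
  by rewrite !inE !xpair_eqE !eqxx !(E _ _ _ _ cd ltda lt_b) /= ?Pb ?Pc ?Pcb; split=> //; apply/negbTE.
- have NPda := NP _ _ _ Pb NPb.
  have {le_c}ac : a < c by apply: ne_le => //; apply: contraNneq NPda => ->.
  have Pbc := P_trans Pb Pc; have bc := P_nat Pbc.
  apply: (obs b d a c) => //; apply: Or43; apply: induced_relationsP => //=; rewrite ?lt_c ?lt_b ?bc //;
  by rewrite !inE !xpair_eqE !eqxx !(E _ _ _ _ lt_b ltda ac) /= ?Pb ?Pc ?Pbc; split=> //; apply/negbTE.
- have NPda := NP _ _ _ Pb NPb.
  have NPbc := NP' _ _ _ Pc NPb; have NPcb := NP' _ _ _ Pb NPc.
  have {le_c}cd : c < d by apply: ne_le => //; apply: contraNneq NPda => <-.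
  case: (ltngtP b c) => [bc|cb|/val_inj bc]; last by rewrite bc Pc in NPb.
  + apply: (obs b c d a) => //; apply: Or41; apply: induced_relationsP => //=; rewrite ?lt_c ?lt_b //;
    by rewrite !inE !xpair_eqE !eqxx !(E _ _ _ _ bc cd ltda) /= ?Pb ?Pc; split=> //; apply/negbTE.
  + apply: (obs c b d a) => //; apply: Or42; apply: induced_relationsP => //=; rewrite ?lt_c ?lt_b //;
    by rewrite !inE !xpair_eqE !eqxx !(E _ _ _ _ cb lt_b ltda) /= ?Pb ?Pc; split=> //; apply/negbTE.
Qed.

End ForcedOrder.

(** In (i) and (ii), [y c + y d - y a - y b] would be both above 2 and at most 2; in (iii) and (iv),
    [y d - y a] would be. *)
Lemma sleek_no_obstruction (R : realType) n (P : rel 'I_n) (a b c d : 'I_n) :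
  sleek R P -> a < b -> b < c -> c < d -> ~ obstruction P a b c d.
Proof.
move=> [Q [[_ [y Qy]] PQ]] ab bc cd.
have Py (i j : 'I_n) : i < j -> P i j = (1 < y j - y i)%R.
  by move=> ij; apply/idP/idP => [/PQ[/Qy]|/Qy Qij] //; apply/PQ.
have ne := @ord_ltn_eqF n.
have ac := ltn_trans ab bc; have bd := ltn_trans bc cd; have ad := ltn_trans ab bd.
have rels r : induced_relations P [:: a; b; c; d] r ->
    [/\ ((1 < y b - y a)%R = ((a, b) \in r)), ((1 < y c - y a)%R = ((a, c) \in r))
      & ((1 < y d - y a)%R = ((a, d) \in r))] /\
    [/\ ((1 < y c - y b)%R = ((b, c) \in r)), ((1 < y d - y b)%R = ((b, d) \in r))
      & ((1 < y d - y c)%R = ((c, d) \in r))].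
  by move=> Pr; split; split; rewrite -Py // Pr // !inE eqxx ?orbT.
have E := (ne _ _ ab, ne _ _ bc, ne _ _ cd, ne _ _ ac, ne _ _ bd, ne _ _ ad).
by case=> /rels; rewrite !inE !xpair_eqE !eqxx !E /= => -[[Hab Hac Had] [Hbc Hbd Hcd]]; lra.
Qed.

Theorem theorem8p4 (R : realType) (n : nat) (P : rel 'I_n)
    (posetP : strict_poset P) (naturalP : natural P) :
  sleek R P <->
  ~ (exists a b c d : 'I_n,
       [/\ (a < b)%N, (b < c)%N, (c < d)%N & obstruction P a b c d]).
Proof.
have [P_irr P_trans] := posetP; split=> [sleekP [a [b [c [d [ab bc cd]]]]]|Nobs].
  exact: (sleek_no_obstruction sleekP).
by apply: sleek_of_forced_lt => //; apply: forced_lt_asym.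
Qed.
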